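(* Let $K$ be an oriented virtual knot or link diagram, and let $G_K(s,t)\in\mathbb{Z}[s^{\pm1},t^{\pm1}]$ be its generalized Alexander polynomial (defined up to multiplication by $\pm s^it^j$, $i,j\in\mathbb{Z}$). If $K$ is equivalent, as a virtual link diagram, to a classical diagram (that is, a diagram with no virtual crossings), then $G_K(s,t)=0$.
   Context: A virtual link diagram is a 4-regular plane graph (possibly with additional circle components without vertices), each of whose vertices is marked either as a real crossing (with the usual over/under information) or as a virtual crossing (no over/under information). Two oriented virtual link diagrams are equivalent if they are related by planar isotopy and a finite sequence of generalized Reidemeister moves: (A) the classical Reidemeister moves I, II, III on real crossings; (B) the analogous moves I, II, III in which all crossings are virtual; (C) the mixed move in which an arc passing through two consecutive virtual crossings is moved across a real crossing. All orientations of strands are allowed. Generators: one generator is taken for each edge of the diagram $K$, where labels pass unchanged through virtual crossings, so that an edge effectively runs along a component from one real crossing to the next. A component that meets no real crossing carries a single generator, on which no crossing relation is imposed. Crossing relations: at a real crossing let $a$ be the incoming edge of the undercrossing strand, $b$ the incoming edge of the overcrossing strand, $c$ the outgoing edge of the undercrossing strand and $d$ the outgoing edge of the overcrossing strand. At a positive crossing the two relations are $$c=ta+(1-st)b,\qquad d=sb,$$ and at a negative crossing they are $$c=t^{-1}a+(1-s^{-1}t^{-1})b,\qquad d=s^{-1}b.$$ A crossing is positive if (direction of over strand, direction of under strand) is a positively oriented basis of the plane, and negative otherwise. The module $ABQ(K)$ (the Alexander biquandle of $K$) is the $\mathbb{Z}[s^{\pm1},t^{\pm1}]$-module with these generators,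 subject to the two relations at each real crossing. The generalized Alexander polynomial $G_K(s,t)$ is the determinant of the matrix of coefficients of this system of linear relations, considered up to multiplication by $\pm s^it^j$ with $i,j\in\mathbb{Z}$; up to such multiples it is an invariant of the virtual knot or link. (Eliminating generators by means of relations changes the determinant only by such units.) If every component meets a real crossing and there are $n$ real crossings, this is a $2n\times 2n$ matrix. For each component meeting no real crossing, the matrix is made square by including the trivial relation $0=0$ (a zero row) for its single generator. *)

(* Defs.v *)
From HB Require Import structures.
From Stdlib Require Import Relation_Operators.
From mathcomp Require Import all_boot all_order all_algebra.
From mathcomp Require Import boolp ring.

Set Implicit Arguments.
Unset Strict Implicit.
Unset Printing Implicit Defensive.

Import Order.TTheory GRing.Theory Num.Theory.

(** * The Laurent polynomial ring Z[s^±1, t^±1]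

    It is realised as the subring of Q(s, t) = Frac(Z[s][t]) formed by the
    fractions whose denominator is a monomial. *)

Local Open Scope ring_scope.

Definition ratfun := {fraction {poly {poly int}}}.
Definition sfrac : ratfun := FracField.tofrac ('X%:P : {poly {poly int}}).
Definition tfrac : ratfun := FracField.tofrac ('X : {poly {poly int}}).

Definition is_laurent : {pred ratfun} := fun x =>
  `[< exists (i j : nat) (p : {poly {poly int}}),
        x * sfrac ^+ i * tfrac ^+ j = FracField.tofrac p >].

Lemma sfrac_neq0 : sfrac != 0.
Proof. by rewrite tofrac_eq0 polyC_eq0 polyX_eq0. Qed.

Lemma tfrac_neq0 : tfrac != 0.
Proof. by rewrite tofrac_eq0 polyX_eq0. Qed.

Lemma is_laurent_subring : subring_closed is_laurent.
Proof.
split.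
- by apply/asboolP; exists 0%N, 0%N, 1; rewrite !expr0 !mulr1 rmorph1.
- move=> x y /asboolP[i [j [p xE]]] /asboolP[k [l [q yE]]].
  apply/asboolP; exists (i + k)%N, (j + l)%N,
    (p * ('X%:P ^+ k * 'X ^+ l) - q * ('X%:P ^+ i * 'X ^+ j)).
  rewrite rmorphB !rmorphM !rmorphXn /= -xE -yE -/sfrac -/tfrac !exprD.
  by ring.
- move=> x y /asboolP[i [j [p xE]]] /asboolP[k [l [q yE]]].
  apply/asboolP; exists (i + k)%N, (j + l)%N, (p * q).
  by rewrite rmorphM /= -xE -yE !exprD; ring.
Qed.

HB.instance Definition _ :=
  GRing.isSubringClosed.Build ratfun is_laurent is_laurent_subring.

Record laurent := Laurent { lval :> ratfun; _ : lval \in is_laurent }.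

HB.instance Definition _ := [isSub for lval].
HB.instance Definition _ := [Choice of laurent by <:].
HB.instance Definition _ := [SubChoice_isSubComNzRing of laurent by <:].

Lemma monomial_subproof (i j : int) : sfrac ^ i * tfrac ^ j \in is_laurent.
Proof.
have shift (z : ratfun) (k : int) : z != 0 ->
    exists m n : nat, z ^ k * z ^+ m = z ^+ n.
  move=> z0; case: k => k; first by exists 0%N, k; rewrite expr0 mulr1.
  by exists k.+1, 0%N; rewrite NegzE -exprnN mulVf // expf_neq0.
have [m [n sE]] := shift _ i sfrac_neq0.
have [k [l tE]] := shift _ j tfrac_neq0.
apply/asboolP; exists m, k, ('X%:P ^+ n * 'X ^+ l).
by rewrite rmorphM !rmorphXn /= -/sfrac -/tfrac -sE -tE -!mulrA;
   congr (_ * _); rewrite mulrCA.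
Qed.

(** [monomial i j] is s^i t^j. *)
Definition monomial (i j : int) : laurent := Laurent (monomial_subproof i j).

Local Close Scope ring_scope.

(** * Oriented virtual link diagrams

    An oriented 4-regular plane graph with crossings [V], edges [E] (among which
    the circle components without vertices) and faces [F], up to isotopy.
    At every crossing two strands cross transversally; strand [false] is the
    first and strand [true] the second one, numbered so that (direction of the
    first, direction of the second) is a positive basis of the plane.  So, with
    the first strand heading east and the second one north, the edges at [v] are
      east: out (v, false)      north: out (v, true)
      west: inc (v, false)      south: inc (v, true).
    A pair [(v, i)] stands for the passage of strand [i] through [v].
    [over v] is [None] if [v] is virtual, and [Some i] if [v] is real with strand
    [i] on top.  An edge that is neither outgoing nor incoming at any crossing is
    a circle component.  [lface e] and [rface e] are the faces of the plane graph
    on the left and on the right of [e]; a face may have several boundary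
    components, so the relative position of the connected components of the
    graph is recorded.  [outer] is the unbounded face. *)

Record vmap (V E F : finType) := VMap {
  over : V -> option bool;
  inc : V * bool -> E;
  out : V * bool -> E;
  lface : E -> F;
  rface : E -> F;
  outer : F
}.

Section Plane.
Variables (V E F : finType) (D : vmap V E F).

Definition sharing (e e' : E) : bool :=
  [exists v, [exists i, (e == inc D (v, i)) || (e == out D (v, i))] &&
             [exists i, (e' == inc D (v, i)) || (e' == out D (v, i))]].

Definition separated (f g : F) : bool :=
  [exists e, ((lface D e == f) && (rface D e == g)) ||
             ((lface D e == g) && (rface D e == f))].

(** Gluing the faces to the graph along the sides of the edges gives a closed
    oriented surface.  It is connected iff any two faces can be joined by
    crossing edges ([plane_connected]).  The last field is Euler's formula
    V - E + F = 1 + C for a plane graph with C connected components (a circle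
    counts as one component and contributes 0 to V - E; the other edges number
    2V).  As V - E + W <= 2C, where W is the number of boundary components of
    the faces, and as C + F <= W + 1 by connectedness, Euler's formula says
    exactly that the surface is a sphere. *)
Record plane : Prop := Plane {
  plane_inc : injective (inc D);
  plane_out : injective (out D);
  plane_circle : codom (inc D) =i codom (out D);
  plane_NE : forall v, lface D (out D (v, false)) = rface D (out D (v, true));
  plane_NW : forall v, lface D (out D (v, true)) = lface D (inc D (v, false));
  plane_SW : forall v, rface D (inc D (v, false)) = lface D (inc D (v, true));
  plane_SE : forall v, rface D (inc D (v, true)) = rface D (out D (v, false));
  plane_connected : forall f g, connect separated f g;
  plane_euler : #|F| = (#|V| + n_comp sharing E).+1
}.

(** [straight S e e'] : one of [e], [e'] continues straight into the other one
    through a crossing of [S]. *)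
Definition straight (S : {set V}) (e e' : E) : bool :=
  [exists p : V * bool, (p.1 \in S) &&
     (((e == inc D p) && (e' == out D p)) ||
      ((e' == inc D p) && (e == out D p)))].

(** [f] is a bounded face, bordered exactly by the edges of [I], each of them
    with one side only.  Where it is used, [I] consists of the sides of a
    polygon, so that [f] is the open disc inside. *)
Definition polygon (f : F) (I : {set E}) : Prop :=
  f <> outer D /\
  forall e, (lface D e == f) + (rface D e == f) = (e \in I) :> nat.

End Plane.

Record diagram := Diagram {
  crossing : finType;
  edge : finType;
  face : finType;
  map_of :> vmap crossing edge face;
  map_plane : plane map_of
}.

(** A classical diagram has no virtual crossings. *)
Definition classical (K : diagram) : Prop :=
  forall v : crossing K, over K v <> None.

(** * Planar isotopy and the generalized Reidemeister moves *)

Section Moves.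
Variables (V E F V' E' F' : finType) (D' : vmap V' E' F') (D : vmap V E F).

Definition isotopic : Prop :=
  exists (h : V' -> V) (k : E' -> E) (r : F' -> F),
    [/\ bijective h, bijective k & bijective r] /\
    [/\ forall v, over D (h v) = over D' v,
        forall v i, inc D (h v, i) = k (inc D' (v, i)),
        forall v i, out D (h v, i) = k (out D' (v, i)),
        forall e, lface D (k e) = r (lface D' e) /\
                  rface D (k e) = r (rface D' e) &
        outer D = r (outer D')].

(** [D] is obtained from [D'] by pulling apart the strands that cross at the
    crossings of [S] and bound the polygon [f] with sides [I]: the crossings in
    [S] disappear, the edges that continue each other through them merge, and
    outside of the disc where this happens nothing changes.  ([D] and [D'] being
    plane, Euler's formula leaves no freedom in [r]: away from [f] it is onto
    and can identify only the two faces that are joined when two strands are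
    pulled apart.) *)
Definition pulls_apart (S : {set V'}) (I : {set E'}) (f : F') : Prop :=
  exists (h : V -> V') (k : E' -> E) (r : F' -> F),
    [/\ injective h,
        forall v', (v' \in codom h) = (v' \notin S),
        forall e, exists e', k e' = e &
        forall e1 e2, k e1 = k e2 <-> connect (straight D' S) e1 e2] /\
    [/\ forall v, over D v = over D' (h v),
        forall v i, inc D (v, i) = k (inc D' (h v, i)) &
        forall v i, out D (v, i) = k (out D' (h v, i))] /\
    [/\ forall e, e \notin I -> lface D (k e) = r (lface D' e) /\
                                rface D (k e) = r (rface D' e),
        outer D = r (outer D') &
        polygon D' f I].

(** Move I, real ([over v] is not [None]) or virtual: removal of the crossing
    [v] of a curl.  The choice of [i] gives both ways of turning. *)
Definition move1 : Prop :=
  exists v i f,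
    out D' (v, i) = inc D' (v, ~~ i) /\
    pulls_apart [set v] [set out D' (v, i)] f.

(** Move II, real or virtual: removal of the crossings [u], [v] of a bigon.  One
    strand runs from [u] to [v]; the other one runs from [u] to [v] if [par], and
    from [v] to [u] otherwise.  As they cross in opposite directions at [u] and
    [v], each strand has different numbers there; so the condition on [over] says
    that both crossings are virtual, or that the same strand is on top twice. *)
Definition move2 : Prop :=
  exists u v i (par : bool) f,
    let m := if par then (u, ~~ i) else (v, i) in
    let n := if par then (v, i) else (u, ~~ i) in
    [/\ u <> v,
        out D' (u, i) = inc D' (v, ~~ i),
        out D' m = inc D' n,
        over D' v = omap negb (over D' u) &
        pulls_apart [set u; v] [set out D' (u, i); out D' m] f].

End Moves.

Section Triangle.
Variables (V E F : finType) (D D' : vmap V E F).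

(** In [D] a strand does the passage [m], runs along [e], and does the passage
    [n]; in [D'] the order of the two passages is reversed. *)
Definition reversed (m n : V * bool) (e : E) : Prop :=
  [/\ out D m = e, inc D n = e, out D' n = e & inc D' m = e] /\
  inc D' n = inc D m /\ out D' m = out D n.

(** Move III and the mixed move.  Strands x and y cross at [p], x and z at [q],
    y and z at [r]; x is strand [a] at [p] and [b] at [q], and y is strand [c] at
    [r].  The edges [ex], [ey], [ez] of x, y, z bound a triangle [f], both before
    and after the move.  Moving a strand across the crossing of the two others
    reverses the order of the two passages on each of the strands, without
    changing which strand is first or second at the three crossings.  Either all
    crossings are real, with x on top, y in the middle and z at the bottom; or x
    is virtual at its two crossings, and the crossing of y and z is virtual
    (virtual move III) or real (mixed move). *)
Definition move3 : Prop :=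
  exists (p q r : V) (a b c : bool) (ex ey ez : E) (f : F),
    let I := [set ex; ey; ez] in
    [/\ uniq [:: p; q; r],
        [/\ over D p = Some a, over D q = Some b & over D r = Some c] \/
        (over D p = None /\ over D q = None) &
        over D' =1 over D] /\
    [/\ reversed (p, a) (q, b) ex \/ reversed (q, b) (p, a) ex,
        reversed (p, ~~ a) (r, c) ey \/ reversed (r, c) (p, ~~ a) ey,
        reversed (q, ~~ b) (r, ~~ c) ez \/ reversed (r, ~~ c) (q, ~~ b) ez &
        forall v i, v \notin [:: p; q; r] ->
          inc D' (v, i) = inc D (v, i) /\ out D' (v, i) = out D (v, i)] /\
    [/\ forall e, e \notin I -> lface D' e = lface D e /\
                                rface D' e = rface D e,
        outer D' = outer D,
        polygon D f I &
        polygon D' f I].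

End Triangle.

Inductive move : diagram -> diagram -> Prop :=
| Isotopy (K L : diagram) : isotopic K L -> move K L
| MoveI (K L : diagram) : move1 K L -> move K L
| MoveII (K L : diagram) : move2 K L -> move K L
| MoveIII (V E F : finType) (D D' : vmap V E F) (hD : plane D)
    (hD' : plane D') : move3 D D' -> move (Diagram hD) (Diagram hD').

Definition equivalent : diagram -> diagram -> Prop :=
  clos_refl_sym_trans diagram move.

(** * The generalized Alexander polynomial *)

Section Alexander.
Local Open Scope ring_scope.
Variable K : diagram.

(** An arc is a maximal sequence of edges that continue each other straight
    through virtual crossings; it is represented by one of its edges.  The arcs
    are the generators of the Alexander biquandle. *)
Definition same_arc : rel (edge K) :=
  straight K [set v | over K v == None].
Definition arc (e : edge K) : edge K := fingraph.root same_arc e.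
Definition arcs : {pred edge K} := roots same_arc.

(** The crossing is positive iff the strand on top is the first one. *)
Definition crossing_sign (o : bool) : int := if o then -1 else 1.

(** Coefficient of the generator [y] in the relation of the passage [p], with
    everything on the left: d - s^±1 b if [p] is the overpass, and
    c - (t^±1 a + (1 - s^±1 t^±1) b) if it is the underpass. *)
Definition relation_coef (p : crossing K * bool) (y : edge K) : laurent :=
  let gen e : laurent := (arc e == y)%:R in
  match over K p.1 with
  | None => 0
  | Some o =>
      let w := crossing_sign o in
      if p.2 == o then gen (out K p) - monomial w 0 * gen (inc K p)
      else gen (out K p) - (monomial 0 w * gen (inc K p) +
                            (1 - monomial w w) * gen (inc K (p.1, o)))
  end.

(** Every relation is attached to the arc that starts at its passage.  An arc
    that starts at no real crossing is a whole component meeting no real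
    crossing, and gets the trivial relation. *)
Definition matrix_coef (x y : edge K) : laurent :=
  if [pick p | (over K p.1 != None) && (arc (out K p) == x)] is Some p
  then relation_coef p y else 0.

Definition alexander_matrix : 'M[laurent]_#|arcs| :=
  \matrix_(i, j) matrix_coef (enum_val i) (enum_val j).

(** G_K(s, t) is defined up to multiplication by ± s^i t^j. *)
Definition gen_alexander (g : laurent) : Prop :=
  exists (n : bool) (i j : int),
    g = (-1) ^+ n * monomial i j * \det alexander_matrix.

End Alexander.

(* Main.v *)
From mathcomp Require Import all_boot all_order all_algebra.
From mathcomp Require Import boolp ring zify.
From Stdlib Require Import Relation_Operators.
Require Import Defs.

(** Over the field Q(s, t) the determinant vanishes iff the system of crossing
    relations has a nonzero solution, a "coloring" of the edges.  Each
    Reidemeister move identifies the colorings of the two diagrams: the colors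
    of the edges in the disc of the move are determined by the colors of the
    strands entering it.  For move III this uses that the triangle is planar,
    which restricts the signs of the crossings and the orders in which the
    strands meet them.

    A classical diagram has the coloring e |-> s ^ (- lam e), where lam e is the
    Alexander number of the face on the left of e (crossing an edge from right
    to left raises the number by 1): with c e = s ^ (- lam e) * y e the relations
    become those of the Alexander quandle with parameter st in the y e, which
    y = 1 satisfies.  The numbering exists because on a sphere every flow is a
    coboundary; Euler's formula gives the dimension count. *)

Set Implicit Arguments.
Unset Strict Implicit.
Unset Printing Implicit Defensive.
Import Order.TTheory GRing.Theory Num.Theory.
Local Open Scope ring_scope.

Lemma neq_negb (i j : bool) : i != j -> i = ~~ j.
Proof. by case: i j => [] []. Qed.

(** * Alexander numbering *)

(** The hypothesis makes the rows of the block matrix with blocks [A] and [B] independent. Thus [k]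
    conditions that determine a vector in the left kernel of [A] give a lower bound for the rank of
    [A]. *)
Lemma leq_rank_add (K : fieldType) m n k (A : 'M[K]_(m, n)) (B : 'M[K]_(m, k)) :
  (forall x : 'rV_m, x *m A = 0 -> x *m B = 0 -> x = 0) -> (m <= \rank A + k)%N.
Proof.
move=> H; have /eqP rAB : row_free (row_mx A B).
  by apply: inj_row_free => x /eqP; rewrite mul_mx_row row_mx_eq0
    => /andP[/eqP xA /eqP xB]; apply: H.
rewrite -[X in (X <= _)%N]rAB -mxrank_tr tr_row_mx -addsmxE.
apply: leq_trans (mxrank_adds_leqif _ _) _.
by rewrite !mxrank_tr leq_add2l rank_leq_col.
Qed.

Section Numbering.
Variables (V E F : finType) (D : vmap V E F).
Hypothesis pD : plane D.

Let inj := plane_inc pD.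
Let injo := plane_out pD.

Definition coboundary : 'M[rat]_(#|F|, #|E|) := \matrix_(i, j)
  ((lface D (enum_val j) == enum_val i)%:R
   - (rface D (enum_val j) == enum_val i)%:R).

(** A row vector of edge values is sent to its net outflow at each crossing; the left kernel
    consists of the flows. *)
Definition boundary : 'M[rat]_(#|E|, #|V|) := \matrix_(i, j)
  \sum_(b : bool) ((enum_val i == out D (enum_val j, b))%:R
                   - (enum_val i == inc D (enum_val j, b))%:R).

Lemma sum_enum_delta (T : finType) (x : T -> rat) (t : T) :
  \sum_(i < #|T|) x (enum_val i) * (t == enum_val i)%:R = x t.
Proof.
rewrite (bigD1 (enum_rank t)) //= enum_rankK eqxx mulr1 big1 ?addr0 // => i it.
by rewrite -(inj_eq enum_rank_inj) enum_valK eq_sym (negPf it) mulr0.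
Qed.

Lemma mul_coboundary m (x : 'M_(m, #|F|)) i e :
  (x *m coboundary) i (enum_rank e) =
    x i (enum_rank (lface D e)) - x i (enum_rank (rface D e)).
Proof.
pose y f := x i (enum_rank f).
rewrite !mxE -[RHS]/(y _ - y _) -!(sum_enum_delta y) -sumrB.
by apply: eq_bigr => j _; rewrite mxE /y enum_valK enum_rankK mulrBr.
Qed.

Lemma mul_boundary m (x : 'M_(m, #|E|)) i v :
  (x *m boundary) i (enum_rank v) =
    \sum_(b : bool) (x i (enum_rank (out D (v, b)))
                     - x i (enum_rank (inc D (v, b)))).
Proof.
pose y e := x i (enum_rank e).
rewrite !mxE [LHS](eq_bigr (fun j => \sum_(b : bool)
   (y (enum_val j) * (out D (v, b) == enum_val j)%:R -
    y (enum_val j) * (inc D (v, b) == enum_val j)%:R))); last first.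
  move=> j _; rewrite mxE mulr_sumr; apply: eq_bigr => b _.
  by rewrite /y enum_valK enum_rankK mulrBr ![enum_val j == _]eq_sym.
rewrite exchange_big; apply: eq_bigr => b _ /=.
by rewrite sumrB !sum_enum_delta.
Qed.

Lemma mul_tr_boundary m (x : 'M_(m, #|V|)) i v b w b' :
  out D (v, b) = inc D (w, b') ->
  (x *m boundary^T) i (enum_rank (out D (v, b))) =
    x i (enum_rank v) - x i (enum_rank w).
Proof.
move=> e; pose y v := x i (enum_rank v).
rewrite !mxE -[RHS]/(y _ - y _) -!(sum_enum_delta y) -sumrB.
apply: eq_bigr => j _; rewrite !mxE enum_rankK -mulrBr /y enum_valK.
congr (_ * _); rewrite sumrB; congr (_ - _).
  rewrite (bigD1 b) //= (inj_eq injo) xpair_eqE eqxx andbT big1 ?addr0 // => k kb.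
  by rewrite (inj_eq injo) xpair_eqE eq_sym [b == _]eq_sym (negPf kb) andbF.
rewrite e (bigD1 b') //= (inj_eq inj) xpair_eqE eqxx andbT big1 ?addr0 // => k kb.
by rewrite (inj_eq inj) xpair_eqE eq_sym [b' == _]eq_sym (negPf kb) andbF.
Qed.

(** Each of the four corners at a crossing enters two of the edge differences, with opposite
    signs. *)
Lemma coboundary_boundary : coboundary *m boundary = 0.
Proof.
apply/matrixP => i j; rewrite mxE -[j]enum_valK.
have := mul_boundary coboundary i (enum_val j); rewrite mxE => ->.
have [_ _ _ NE NW SW SE _ _] := pD.
rewrite big_bool !mxE !enum_rankK NE NW -SE SW.
by rewrite /=; ring.
Qed.

(** A face function without differences across edges is constant by connectedness, so its value at
    [outer] determines it. *)
Lemma rank_coboundary : (#|F| <= \rank coboundary + 1)%N.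
Proof.
apply: (leq_rank_add (B := \col_(i < #|F|) (outer D == enum_val i)%:R))
  => x x0 xo.
have sep f g : separated D f g -> x 0 (enum_rank f) = x 0 (enum_rank g).
  have lr e : x 0 (enum_rank (lface D e)) = x 0 (enum_rank (rface D e)).
    by apply/eqP; rewrite -subr_eq0 -mul_coboundary x0 mxE.
  by case/existsP=> e /orP[] /andP[/eqP<- /eqP<-]; rewrite lr.
have conn f g :
    connect (separated D) f g -> x 0 (enum_rank f) = x 0 (enum_rank g).
  case/connectP=> p; elim: p f => [|h p IHp] f /=; first by move=> _ ->.
  by case/andP=> /sep-> /IHp{}IHp /IHp.
apply/matrixP => i j; rewrite ord1 mxE -[j]enum_valK.
rewrite -(conn _ _ (plane_connected pD (outer D) _)).
have := congr1 (fun M : 'M_(1, 1) => M 0 0) xo; rewrite !mxE => <-.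
rewrite -(sum_enum_delta (fun f => x 0 (enum_rank f))).
by apply: eq_bigr => k _; rewrite mxE enum_valK.
Qed.

Let touched : pred E := [pred e in codom (inc D)].

Lemma sharing_sym : connect_sym (sharing D).
Proof.
apply: sym_connect_sym => e e'; apply: eq_existsb => v.
exact: andbC.
Qed.

(** A vector in the left kernel of the transpose agrees at the two ends of every edge, so it is
    constant on components. One value for each component with crossings determines it. *)
Lemma rank_boundary :
  (#|V| <= \rank boundary + #|predI (roots (sharing D)) touched|)%N.
Proof.
pose B : 'M[rat]_(#|V|, #|predI (roots (sharing D)) touched|) :=
  \matrix_(i, j) \sum_(b : bool) (enum_val j == inc D (enum_val i, b))%:R.
rewrite -mxrank_tr; apply: (leq_rank_add (B := B)) => x x0 xB.
pose y v := x 0 (enum_rank v).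
(* Components are defined on edges, so [y] is moved there: [c e] is the value at the crossing that
   [e] enters, and 0 if [e] is a circle. *)
pose c e := if [pick p | inc D p == e] is Some p then y p.1 else 0.
have c_inc v b : c (inc D (v, b)) = y v.
  by rewrite /c; case: pickP => [p /eqP/inj->|/(_ (v, b))/eqP].
have c_out v b : c (out D (v, b)) = y v.
  have /codomP[[w b'] e] : out D (v, b) \in codom (inc D).
    by rewrite (plane_circle pD) codom_f.
  rewrite e c_inc; apply/esym/eqP; rewrite -subr_eq0.
  by rewrite -(mul_tr_boundary _ _ e) x0 mxE.
have cE e e' : connect (sharing D) e e' -> c e = c e'.
  case/connectP=> p; elim: p e => [|h p IHp] e /=; first by move=> _ ->.
  case/andP=> /existsP[v /andP[/existsP[i ei] /existsP[j hj]]] /IHp{}IHp /IHp <-.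
  have -> : c e = y v by case/orP: ei => /eqP->.
  by case/orP: hj => /eqP->.
apply/matrixP => i j; rewrite ord1 mxE -[j]enum_valK -/(y _) -(c_inc _ true).
rewrite (cE _ _ (connect_root _ _)); set r := fingraph.root _ _.
have [[w b] rE|untouched] := pickP (fun p => inc D p == r); last first.
  by rewrite /c; case: pickP => // p; rewrite untouched.
have rI : r \in predI (roots (sharing D)) touched.
  apply/andP; split; first exact: roots_root sharing_sym _.
  by rewrite -(eqP rE); apply: codom_f.
have := congr1 (fun M : 'M_(1, _) => M 0 (enum_rank_in rI r)) xB.
have -> : c r = y w by rewrite -(eqP rE) c_inc.
rewrite !mxE => <-; rewrite -(sum_enum_delta y).
apply: eq_bigr => k _; rewrite mxE /y enum_valK; congr (_ * _).
rewrite enum_rankK_in // -(eqP rE) (bigD1 b) //= (inj_eq inj) xpair_eqE eqxx.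
rewrite andbT big1 ?addr0 // => b' b'b.
by rewrite (inj_eq inj) xpair_eqE [b == _]eq_sym (negPf b'b) andbF.
Qed.

(** A circle shares a crossing with no edge, so it is a component by itself and its own root. *)
Lemma card_components : n_comp (sharing D) E =
  (#|predI (roots (sharing D)) touched| + #|predC touched|)%N.
Proof.
rewrite /n_comp_mem -(cardID touched); congr (_ + _)%N; apply: eq_card => e.
  by rewrite !inE andbT.
rewrite !inE andbT; apply: andb_idr => untouched.
have /connectP[[|h p] /= + rE] := connect_root (sharing D) e.
  by move=> _; apply/eqP.
case/andP=> /existsP[v /andP[/existsP[i ei] _]] _.
case/negP: untouched; case/orP: ei => /eqP->; first exact: codom_f.
by rewrite (plane_circle pD) codom_f.
Qed.

(** Let there be [C] components with crossings and [O] circles. Euler's formula gives [coboundary]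
    rank at least [V + C + O], and the flows have dimension at most [2V + O - (V - C)], the same
    number. So every flow is a coboundary. *)
Lemma alexander_numbering :
  exists lam : F -> int, forall e, lam (lface D e) = lam (rface D e) + 1.
Proof.
have cE : #|E| = (2 * #|V| + #|predC touched|)%N.
  by rewrite -(cardC touched) card_codom // card_prod card_bool mulnC.
have rA := rank_coboundary; have rB := rank_boundary.
have cC := card_components; have cF := plane_euler pD.
have AB0 := coboundary_boundary.
have sAB : (coboundary <= kermx boundary)%MS by apply/sub_kermxP.
have rAB : \rank coboundary = \rank (kermx boundary).
  apply/eqP; rewrite eqn_leq mxrankS // mxrank_ker.
  have := rank_leq_row boundary; lia.
(* The constant 1 is a flow, since two edges enter and two leave each crossing. *)
have : ((const_mx 1 : 'rV_#|E|) <= coboundary)%MS.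
  have [_] := mxrank_leqif_sup sAB; rewrite rAB eqxx => /esym; apply: submx_trans.
  apply/sub_kermxP/matrixP => i j; rewrite -[j]enum_valK mul_boundary !mxE.
  by rewrite big1 // => b _; rewrite !mxE subrr.
case/submxP => x xE.
(* The potential is only rational; taking floors keeps the differences equal to 1. *)
exists (fun f => Num.floor (x 0 (enum_rank f))) => e.
have := mul_coboundary x 0 e; rewrite -xE mxE => /eqP.
rewrite eq_sym subr_eq => /eqP ->.
by rewrite addrC floorDrz ?floor1.
Qed.
End Numbering.

(** * Colorings and moves *)

(* Of the edges at [v], [f] touches one of strand [a] and one of the other strand;
   it lies in the corner between them, which fixes its side. *)
Lemma corner_side (V E F : finType) (D : vmap V E F) (pD : plane D) v a
    (o1 o2 : bool) (f : F) :
  let side (o : bool) p := if o then out D p else inc D p in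
  ((lface D (side o1 (v, a)) == f) + (rface D (side o1 (v, a)) == f) = 1)%N ->
  ((lface D (side (~~ o2) (v, ~~ a)) == f) +
    (rface D (side (~~ o2) (v, ~~ a)) == f) = 0)%N ->
  (lface D (side o1 (v, a)) == f) = o2 (+) a.
Proof.
have [_ _ _ NE NW SW SE _ _] := pD.
move=> side; rewrite /side; case: a o1 o2 => [] [] [] /=;
  rewrite ?NE ?NW ?SW ?SE -?NE -?NW -?SW -?SE.
all: do 4?case: eqP => //=; congruence.
Qed.

(** The Boolean [o] records whether [D] does [m] before [n], so that both orders are treated by one
    formula. *)
Lemma reversed_order (V E F : finType) (D D' : vmap V E F) m n e :
  reversed D D' m n e \/ reversed D D' n m e ->
  exists o : bool,
    [/\ inc D (if o then n else m) = e, out D (if o then m else n) = e,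
        inc D' (if o then m else n) = e & out D' (if o then n else m) = e] /\
    inc D' (if o then n else m) = inc D (if o then m else n) /\
    out D' (if o then m else n) = out D (if o then n else m).
Proof.
by case=> [[[? ? ? ?] [? ?]]|[[? ? ? ?] [? ?]]]; [exists true | exists false].
Qed.

Lemma move3_sym (V E F : finType) (D D' : vmap V E F) : move3 D D' -> move3 D' D.
Proof.
have rev m n e : reversed D D' m n e -> reversed D' D n m e.
  by move=> [[? ? ? ?] [? ?]].
move=> [p [q [r [a [b [c [ex [ey [ez [f]]]]]]]]]].
move=> /= [[u o oE] [[rx ry rz same] [lr ou pD pD']]].
exists p, q, r, a, b, c, ex, ey, ez, f; split; [|split; split=> //].
- by split=> //; rewrite !oE.
- by case: rx => /rev; [right|left].
- by case: ry => /rev; [right|left].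
- by case: rz => /rev; [right|left].
- by move=> v i /same-/(_ i)[].
- by move=> e /lr[].
Qed.

Section Coloring.
Variables (R : fieldType) (s t : R).

(** Strand [true] on top means a negative crossing, where [s] and [t] are replaced by their
    inverses. *)
Definition signed (o : bool) (x : R) : R := if o then x^-1 else x.

Definition cross (o : option bool) (x : bool -> R) (i : bool) : R :=
  match o with
  | None => x i
  | Some j => if i == j then signed j s * x j
              else signed j t * x i + (1 - signed j s * signed j t) * x j
  end.

Definition colored_at (V E F : finType) (D : vmap V E F) (c : E -> R) (v : V) :=
  forall i, c (out D (v, i)) = cross (over D v) (fun j => c (inc D (v, j))) i.

Definition colorable (V E F : finType) (D : vmap V E F) :=
  exists2 c : E -> R, forall v, colored_at D c v & exists e, c e != 0.

(** The diagrams agree off [S], so only the colors on [I] are chosen anew. The coloring stays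
    nonzero: if it vanished off [I], it would vanish on [I] too. *)
Lemma colorable_recolor (V E F : finType) (D1 D2 : vmap V E F)
    (S : {set V}) (I : {set E}) :
  (forall v i, v \notin S ->
     [/\ over D1 v = over D2 v, inc D1 (v, i) = inc D2 (v, i),
         out D1 (v, i) = out D2 (v, i), inc D1 (v, i) \notin I
       & out D1 (v, i) \notin I]) ->
  (forall c, (forall v, colored_at D1 c v) ->
     (exists2 c', forall e, e \notin I -> c' e = c e
                & forall v, v \in S -> colored_at D2 c' v) /\
     ((forall e, e \notin I -> c e = 0) -> forall e, e \in I -> c e = 0)) ->
  colorable D1 -> colorable D2.
Proof.
move=> same H [c cP [e ce]].
have [[c' c'E c'P] nz] := H c cP.
exists c'.
  move=> v; have [/c'P//|vS] := boolP (v \in S) => i.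
  have [oE _ outE _ outI] := same v i vS.
  rewrite -oE -outE c'E // cP /cross.
  have incE j : c' (inc D2 (v, j)) = c (inc D1 (v, j)).
    by have [_ <- _ incI _] := same v j vS; rewrite c'E.
  by case: (over D1 v) => [o|]; rewrite !incE.
have [/existsP[e' /andP[e'I ce']]|] :=
  boolP [exists e, (e \notin I) && (c e != 0)].
  by exists e'; rewrite c'E.
rewrite negb_exists => /forallP off; case/negP: ce; apply/eqP.
have off0 e' : e' \notin I -> c e' = 0.
  by move=> e'I; apply/eqP; have := off e'; rewrite e'I /= negbK.
by have [/(nz off0)|/off0] := boolP (e \in I).
Qed.

(* The colorings of a diagram obtained by pulling strands apart at [S] are those
   of the original diagram with the crossings of [S] made virtual. *)
Definition virtualize (V E F : finType) (S : {set V}) (D : vmap V E F) :=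
  VMap (fun v => if v \in S then None else over D v)
       (inc D) (out D) (lface D) (rface D) (outer D).

(** Virtual crossings pass colors on, so colorings of the virtualized diagram are constant on the
    fibres of [k]. They descend along a section of [k], and colorings of [D] pull back along [k]. *)
Lemma pulls_apart_colorable (V E F V' E' F' : finType) (D' : vmap V' E' F')
    (D : vmap V E F) S I f :
  pulls_apart D' D S I f -> colorable (virtualize S D') <-> colorable D.
Proof.
move=> [h [k [r [[h_inj hS k_surj kE] [[overE incE outE] _]]]]]; split.
  move=> [c cP [e0 ce0]].
  have cS e1 e2 : connect (straight D' S) e1 e2 -> c e1 = c e2.
    case/connectP=> p; elim: p e1 => [|e p IHp] e1 /=; first by move=> _ ->.
    case/andP=> /existsP[[v i] /andP[/= vS e1e]] /IHp{}IHp /IHp <-.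
    have := cP v i; rewrite /= vS /=.
    by case/orP: e1e => /andP[/eqP-> /eqP->].
  have [g gK] : exists g : E -> E', forall e, k (g e) = e.
    exists (fun e => xchoose (let: ex_intro x kx := k_surj e in
       ex_intro (fun x => k x == e) x (introT eqP kx))).
    by move=> e; apply/eqP; apply: (@xchooseP _ (fun x => k x == e)).
  have cg e : c (g (k e)) = c e by apply/cS/kE.
  exists (c \o g); last by exists (k e0); rewrite /= cg.
  move=> v i; rewrite /= outE cg overE cP /=.
  have /negPf -> : h v \notin S by rewrite -hS codom_f.
  by rewrite /cross; case: (over D' _) => [o|]; rewrite !incE !cg.
move=> [c cP [e0 ce0]]; exists (c \o k); last first.
  by have [e' ke'] := k_surj e0; exists e'; rewrite /= ke'.
move=> v i /=; have [vS|vS] := boolP (v \in S).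
  congr c; apply/kE/connect1/existsP; exists (v, i).
  by rewrite /= vS !eqxx orbT.
move: vS; rewrite -hS => /codomP[w ->].
rewrite -outE cP /cross overE.
by case: (over D' _) => [o|]; rewrite !incE.
Qed.

(** * Reidemeister move I *)

Hypotheses (s0 : s != 0) (t0 : t != 0).

Lemma signed_neq0 o x : x != 0 -> signed o x != 0.
Proof. by case: o => //= x0; rewrite invr_eq0. Qed.

Lemma signedN o x : x != 0 -> signed (~~ o) x = (signed o x)^-1.
Proof. by case: o => //= _; rewrite invrK. Qed.

(** The loop leaves on strand [i] and returns as the other strand. At a real crossing its equation
    forces the loop color to be [signed j s] times the entering color if strand [i] is on top, and
    the inverse of [signed j s] times it otherwise. The curl then returns the entering color. *)
Lemma cross_curl o i x :
  x (~~ i) = cross o x i ->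
  cross o x (~~ i) = x i /\ (x i = 0 -> x (~~ i) = 0).
Proof.
case: o => [j|] /=; last by move=> ->.
have := signed_neq0 j s0; have := signed_neq0 j t0.
move: (signed j s) (signed j t) => a b b0 a0.
have [->|nij] := eqVneq i j.
  have -> : (~~ j == j) = false by case: (j).
  move=> ->; split; first by ring.
  by move=> ->; rewrite mulr0.
move: nij; rewrite eq_sym => /neq_negb ->.
rewrite eqxx => H.
have E : a * x (~~ i) = x i.
  apply: (mulfI b0); rewrite -[RHS](addrK ((1 - a * b) * x (~~ i))) -H.
  by ring.
by split=> // x0; apply: (mulfI a0); rewrite E x0 mulr0.
Qed.

Lemma cross_uncurl o i a : exists2 x : bool -> R,
  x i = a & x (~~ i) = cross o x i /\ cross o x (~~ i) = a.
Proof.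
(* This is the loop color forced by the loop equation. *)
pose l := if o is Some j then
  if i == j then signed j s * a else (signed j s)^-1 * a else a.
exists (fun j => if j == i then a else l); rewrite ?eqxx //.
rewrite /cross /l.
case: o l => [[]|] l; rewrite /l; case: (i) => //=; split; field.
all: by rewrite ?s0 ?t0 ?oner_eq0.
Qed.

Lemma move1_colorable (V E F V' E' F' : finType) (D' : vmap V' E' F')
    (D : vmap V E F) :
  plane D' -> move1 D' D -> colorable D' <-> colorable D.
Proof.
move=> pD [v [i [f [loop pa]]]].
have inj := plane_inc pD; have injo := plane_out pD.
rewrite -(pulls_apart_colorable pa).
set l := out D' (v, i) in loop pa *.
have off w j : w \notin [set v] ->
    inc D' (w, j) \notin [set l] /\ out D' (w, j) \notin [set l].
  rewrite !inE => wv; split.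
    by rewrite loop (inj_eq inj) xpair_eqE negb_and wv.
  by rewrite (inj_eq injo) xpair_eqE negb_and wv.
have in_l : (inc D' (v, i) == l) = false.
  by rewrite loop (inj_eq inj) xpair_eqE eqxx; case: (i).
have out_l : (out D' (v, ~~ i) == l) = false.
  by rewrite (inj_eq injo) xpair_eqE eqxx; case: (i).
split; apply: (colorable_recolor (S := [set v]) (I := [set l])).
- by move=> w j wv /=; have [] := off w j wv; split=> //; move/negPf: wv => ->.
- move=> c cP.
  have := cP v i; rewrite -/l [in LHS]loop.
  move=> /(@cross_curl _ i (fun j => c (inc D' (v, j)))).
  rewrite -cP -loop => -[E0 E1]; split; last first.
    move=> z e; rewrite inE => /eqP ->; apply: E1; apply: z.
    by rewrite inE in_l.
  exists [eta c with l |-> c (inc D' (v, i))].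
    by move=> e; rewrite inE /= => /negPf ->.
  move=> w; rewrite inE => /eqP -> j /=; rewrite inE eqxx /=.
  have [->|/neq_negb->] := eqVneq j i; first by rewrite -/l eqxx in_l.
  by rewrite out_l E0 -loop eqxx.
- by move=> w j wv /=; have [] := off w j wv; split=> //; move/negPf: wv => ->.
- move=> c cP.
  have := cP v i; have := cP v (~~ i).
  rewrite /colored_at /= !inE eqxx /= -/l -loop => E0 E1; split; last first.
    move=> z e; rewrite inE => /eqP ->; rewrite E1; apply: z.
    by rewrite inE in_l.
  have [x xi [xl xo]] := cross_uncurl (over D' v) i (c (inc D' (v, i))).
  exists [eta c with l |-> x (~~ i)].
    by move=> e; rewrite inE /= => /negPf ->.
  move=> w; rewrite inE => /eqP -> j /=.
  have -> : (fun j0 => if inc D' (v, j0) == l then x (~~ i)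
                       else c (inc D' (v, j0))) = x.
    apply: funext => k; have [->|/neq_negb->] := eqVneq k i.
      by rewrite in_l xi.
    by rewrite -loop eqxx.
  have [->|/neq_negb->] := eqVneq j i; first by rewrite -/l eqxx.
  by rewrite out_l xo E0 E1.
Qed.

(** * Reidemeister move II *)

(** Both strands go from the first crossing, with inputs [x], to the second, with inputs [y]. There
    the sign is opposite and the strands have exchanged numbers, so the second map inverts the
    first. *)
Lemma cross_parallel o i x y :
  y (~~ i) = cross o x i -> y i = cross o x (~~ i) ->
  [/\ cross (omap negb o) y (~~ i) = x i, cross (omap negb o) y i = x (~~ i)
   & x i = 0 -> x (~~ i) = 0 -> y (~~ i) = 0 /\ y i = 0].
Proof.
have signs j : signed j s != 0 /\ signed j t != 0 by rewrite !signed_neq0.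
rewrite /cross; case: o => [j|] /=; last by move=> -> ->.
have [a0 b0] := signs j; rewrite !signedN //.
move: (signed j s) (signed j t) a0 b0 => a b a0 b0.
case: i j => [] [] /= -> ->; split; try (by move=> -> ->; rewrite !mulr0 ?addr0);
  field; by rewrite ?a0 ?b0.
Qed.

(** Each crossing receives one strand from outside, [x i] or [y i], and one from the other crossing.
    Solving for the two inner colors shows that each strand leaves with the color it entered
    with. *)
Lemma cross_antiparallel o i x y :
  y (~~ i) = cross o x i -> x (~~ i) = cross (omap negb o) y i ->
  [/\ cross o x (~~ i) = y i, cross (omap negb o) y (~~ i) = x i
   & x i = 0 -> y i = 0 -> y (~~ i) = 0 /\ x (~~ i) = 0].
Proof.
have signs j : signed j s != 0 /\ signed j t != 0 by rewrite !signed_neq0.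
rewrite /cross; case: o => [j|] /=; last by move=> -> ->.
have [a0 b0] := signs j; rewrite !signedN //.
move: (signed j s) (signed j t) a0 b0 => a b a0 b0.
case: i j => [] [] /= e1 e2; split.
all: try (by move=> z1 z2; rewrite ?e2 ?e1 ?e2 z1 z2 !(mulr0, addr0)).
all: rewrite ?e2 ?e1 ?e2; field; by rewrite ?a0 ?b0.
Qed.

(** The upper strand changes color independently of the lower one, so its inner color is computed
    first, and that of the lower strand from it. *)
Lemma cross_antiparallel_ex o i (a b : R) : exists x y : bool -> R,
  [/\ x i = a, y i = b, y (~~ i) = cross o x i
    & x (~~ i) = cross (omap negb o) y i].
Proof.
case: o => [j|]; last first.
  exists (fun j => if j == i then a else b), (fun j => if j == i then b else a).
  by rewrite /= !eqxx; case: (i).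
have [->|/neq_negb->] := eqVneq j i.
  pose x1 := signed i s * a.
  pose y1 := signed (~~ i) t * b + (1 - signed (~~ i) s * signed (~~ i) t) * x1.
  exists (fun j => if j == i then a else y1), (fun j => if j == i then b else x1).
  by rewrite /= ?negbK !eqxx /y1 /x1 /=; case: (i); split.
pose y1 := signed i s * b.
pose x1 := signed (~~ i) t * a + (1 - signed (~~ i) s * signed (~~ i) t) * y1.
exists (fun j => if j == i then a else y1), (fun j => if j == i then b else x1).
by rewrite /= ?negbK !eqxx /x1 /y1 /=; case: (i); split.
Qed.

Lemma move2_colorable (V E F V' E' F' : finType) (D' : vmap V' E' F')
    (D : vmap V E F) :
  plane D' -> move2 D' D -> colorable D' <-> colorable D.
Proof.
move=> pD [u [v [i [par [f [uv]]]]]].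
have inj := plane_inc pD; have injo := plane_out pD.
set l1 := out D' (u, i).
set m := if par then _ else _; set n := if par then _ else (u, ~~ i).
set l2 := out D' m => l1E l2E oE pa.
rewrite -(pulls_apart_colorable pa).
set S := [set u; v] in pa *; set I := [set l1; l2] in pa *.
have {uv} [uv vu] : (u == v) = false /\ (v == u) = false.
  by rewrite [v == u]eq_sym; split; apply/eqP.
have ii : (~~ i == i) = false by case: (i).
have [uS vS] : u \in S /\ v \in S by rewrite !inE !eqxx orbT.
have off w j : w \notin S -> inc D' (w, j) \notin I /\ out D' (w, j) \notin I.
  rewrite !inE !negb_or => /andP[wu wv]; split.
    rewrite l1E l2E !(inj_eq inj) /n !xpair_eqE (negPf wv).
    by case: (par); rewrite !xpair_eqE ?(negPf wv) ?(negPf wu).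
  rewrite !(inj_eq injo) /m !xpair_eqE (negPf wu).
  by case: (par); rewrite !xpair_eqE ?(negPf wv) ?(negPf wu).
have {off} same w j : w \notin S ->
     [/\ over D' w = over (virtualize S D') w,
         inc D' (w, j) \notin I & out D' (w, j) \notin I].
  by move=> wS /=; rewrite (negPf wS); have [] := off w j wS.
have eqi w j k b : (inc D' (w, j) == inc D' (k, b)) = (w == k) && (j == b).
  by rewrite (inj_eq inj) xpair_eqE.
have eqo w j k b : (out D' (w, j) == out D' (k, b)) = (w == k) && (j == b).
  by rewrite (inj_eq injo) xpair_eqE.
have bool2 (P : bool -> Prop) : P i -> P (~~ i) -> forall j, P j.
  by move=> Pi Pni j; have [->|/neq_negb->] := eqVneq j i.
have setS (P : V' -> Prop) : P u -> P v -> forall w, w \in S -> P w.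
  by move=> Pu Pv w; rewrite !inE => /orP[] /eqP->.
have l12 : (l2 == l1) = false.
  by rewrite l1E l2E /n; case: (par); rewrite eqi ?uv ?eqxx ?[i == _]eq_sym ?ii.
have [up [upd upd1 upd2]] : exists up : (E' -> R) -> R -> R -> E' -> R,
    [/\ forall c a b e, e \notin I -> up c a b e = c e,
        forall c a b, up c a b l1 = a & forall c a b, up c a b l2 = b].
  exists (fun c a b e => if e == l1 then a else if e == l2 then b else c e).
  split=> [c a b e|c a b|c a b]; rewrite ?l12 ?eqxx //.
  by rewrite !inE negb_or => /andP[/negPf-> /negPf->].
case: par @m @n @l2 l2E @I {pa} l12 same upd upd1 upd2
  => m n l2 l2E I l12 same upd upd1 upd2.
- have inu j : inc D' (u, j) \notin I by rewrite !inE l1E l2E !eqi uv.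
  have outv j : out D' (v, j) \notin I by rewrite !inE !eqo vu.
  split; apply: (colorable_recolor (S := S) (I := I)).
  + by move=> w j /same-/(_ j)[].
  + move=> c cP.
    have [A B Z] := @cross_parallel (over D' u) i
      (fun j => c (inc D' (u, j))) (fun j => c (inc D' (v, j)))
      (etrans (congr1 c (esym l1E)) (cP u i))
      (etrans (congr1 c (esym l2E)) (cP u (~~ i))).
    rewrite -oE -!cP -l1E -l2E in A B Z; split; last first.
      move=> z; have [z1 z2] := Z (z _ (inu _)) (z _ (inu _)).
      by move=> e; rewrite !inE => /orP[] /eqP ->.
    exists (up c (c (inc D' (u, i))) (c (inc D' (u, ~~ i)))).
      by move=> e /upd.
    apply: setS; apply: bool2; rewrite /= ?uS ?vS /=.
    * by rewrite -/l1 upd1 upd.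
    * by rewrite -/l2 upd2 upd.
    * by rewrite -l2E upd2 upd.
    * by rewrite -l1E upd1 upd.
  + by move=> w j /same-/(_ j)[].
  + move=> c cP.
    have := cP v (~~ i); have := cP v i; have := cP u (~~ i); have := cP u i.
    rewrite /colored_at /= uS vS /= -/l1 -/l2 -l1E -l2E.
    move=> E1 E2 E3 E4; split; last first.
      move=> z e; rewrite !inE => /orP[] /eqP ->.
        by rewrite E1 z.
      by rewrite E2 z.
    pose x j := c (inc D' (u, j)).
    have [A B _] := @cross_parallel (over D' u) i x
       (fun j => cross (over D' u) x (~~ j)) (congr1 _ (negbK i)) erefl.
    (* The sides of the bigon receive the outputs of the crossing at [u]. *)
    pose c' := (up c (cross (over D' u) x i) (cross (over D' u) x (~~ i))).
    exists c'; first by move=> e eI; rewrite /c' upd.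
    have c'u : (fun j => c' (inc D' (u, j))) = x.
      by apply: funext => j; rewrite /c' upd.
    have c'v : (fun j => c' (inc D' (v, j))) =
               (fun j => cross (over D' u) x (~~ j)).
      apply: funext; apply: bool2; first by rewrite /c' -l2E upd2.
      by rewrite /c' -l1E upd1 negbK.
    apply: setS; apply: bool2; rewrite ?c'u ?c'v.
    * by rewrite /c' -/l1 upd1.
    * by rewrite /c' -/l2 upd2.
    * by rewrite /c' upd // oE B E3.
    * by rewrite /c' upd // oE A E4.
- have inu : inc D' (u, i) \notin I.
    by rewrite !inE l1E l2E !eqi uv [i == _]eq_sym ii !andbF.
  have inv : inc D' (v, i) \notin I.
    by rewrite !inE l1E l2E !eqi vu [i == _]eq_sym ii !andbF.
  have outu : out D' (u, ~~ i) \notin I.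
    by rewrite !inE /l1 /l2 /m !eqo uv ii !andbF.
  have outv : out D' (v, ~~ i) \notin I.
    by rewrite !inE /l1 /l2 /m !eqo vu ii !andbF.
  split; apply: (colorable_recolor (S := S) (I := I)).
  + by move=> w j /same-/(_ j)[].
  + move=> c cP.
    have [A B Z] := @cross_antiparallel (over D' u) i
      (fun j => c (inc D' (u, j))) (fun j => c (inc D' (v, j)))
      (etrans (congr1 c (esym l1E)) (cP u i))
      (etrans (congr1 c (esym l2E)) (etrans (cP v i)
         (congr1 (fun o => cross o _ i) oE))).
    rewrite -oE -!cP -l1E -l2E in A B Z; split; last first.
      move=> z; have [z1 z2] := Z (z _ inu) (z _ inv).
      by move=> e; rewrite !inE => /orP[] /eqP ->.
    exists (up c (c (inc D' (u, i))) (c (inc D' (v, i)))).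
      by move=> e /upd.
    apply: setS; apply: bool2; rewrite /= ?uS ?vS /=.
    * by rewrite -/l1 upd1 upd.
    * by rewrite -l2E upd2 upd.
    * by rewrite -/l2 upd2 upd.
    * by rewrite -l1E upd1 upd.
  + by move=> w j /same-/(_ j)[].
  + move=> c cP.
    have := cP v (~~ i); have := cP v i; have := cP u (~~ i); have := cP u i.
    rewrite /colored_at /= uS vS /= -/l1 -/l2 -l1E -l2E.
    move=> E1 E2 E3 E4; split; last first.
      move=> z e; rewrite !inE => /orP[] /eqP ->.
        by rewrite E1 z.
      by rewrite E3 z.
    (* From outside only one input of each crossing is known, so the inner colors come from solving
       the two crossings together. *)
    have [x [y [xi yi y1 x1]]] :=
      cross_antiparallel_ex (over D' u) i (c (inc D' (u, i))) (c (inc D' (v, i))).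
    have [A B _] := cross_antiparallel y1 x1.
    pose c' := (up c (y (~~ i)) (x (~~ i))).
    exists c'; first by move=> e eI; rewrite /c' upd.
    have c'u : (fun j => c' (inc D' (u, j))) = x.
      apply: funext => j; have [->|/neq_negb->] := eqVneq j i.
        by rewrite /c' upd ?xi.
      by rewrite /c' -l2E upd2.
    have c'v : (fun j => c' (inc D' (v, j))) = y.
      apply: funext => j; have [->|/neq_negb->] := eqVneq j i.
        by rewrite /c' upd ?yi.
      by rewrite /c' -l1E upd1.
    apply: setS; apply: bool2; rewrite ?c'u ?c'v ?oE.
    * by rewrite /c' -/l1 upd1.
    * by rewrite /c' upd // A E2 yi.
    * by rewrite /c' -/l2 upd2.
    * by rewrite /c' upd // B E4 xi.
Qed.

(** * Reidemeister move III and the mixed move *)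

Definition strands (a : bool) (u v : R) (j : bool) := if j == a then u else v.

(* Strand [a] has color [u] before and [u'] after the crossing, the other strand
   [v] and [v']. *)
Definition crossing_at (o : option bool) (a : bool) (u v u' v' : R) :=
  u' = cross o (strands a u v) a /\ v' = cross o (strands a u v) (~~ a).

Lemma colored_atE (V E F : finType) (D : vmap V E F) c v a :
  colored_at D c v <->
  crossing_at (over D v) a (c (inc D (v, a))) (c (inc D (v, ~~ a)))
                           (c (out D (v, a))) (c (out D (v, ~~ a))).
Proof.
have strE : strands a (c (inc D (v, a))) (c (inc D (v, ~~ a)))
   = (fun j => c (inc D (v, j))).
  by apply: funext => j; rewrite /strands; have [->|/neq_negb->] := eqVneq j a.
rewrite /crossing_at strE; split=> [H|[Ha Hna] j]; first by split; apply: H.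
by have [->|/neq_negb->] := eqVneq j a.
Qed.

(* In the notation of [move3]: strand x enters the disc with color [X0], leaves it
   with [X1] and has color [x] on its side of the triangle; [ox] says that it
   meets p before q.  Likewise y meets p before r iff [oy], and z meets q before r
   iff [oz].  The move negates [ox], [oy] and [oz]. *)
Definition triangle_coloring (op oq or : option bool) (a b c ox oy oz : bool)
    (X0 X1 Y0 Y1 Z0 Z1 x y z : R) :=
  [/\ crossing_at op a (if ox then X0 else x) (if oy then Y0 else y)
                       (if ox then x else X1) (if oy then y else Y1),
      crossing_at oq b (if ox then x else X0) (if oz then Z0 else z)
                       (if ox then X1 else x) (if oz then z else Z1)
    & crossing_at or c (if oy then y else Y0) (if oz then z else Z0)
                       (if oy then Y1 else y) (if oz then Z1 else z)].

(** Strand x keeps its color and does not affect y and z, which interact only at the third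
    crossing. *)
Lemma triangle_coloring_virtual or a b c ox oy oz X0 X1 Y0 Y1 Z0 Z1 x y z :
  triangle_coloring None None or a b c ox oy oz X0 X1 Y0 Y1 Z0 Z1 x y z ->
  (exists x' y' z', triangle_coloring None None or a b c (~~ ox) (~~ oy) (~~ oz)
                      X0 X1 Y0 Y1 Z0 Z1 x' y' z') /\
  (X0 = 0 -> Y0 = 0 -> Z0 = 0 -> [/\ x = 0, y = 0 & z = 0]).
Proof.
move=> [Hp Hq Hr]; have nb j : (~~ j == j) = false by case: j.
move: Hp Hq; rewrite /crossing_at /= /strands !eqxx !nb => Hp Hq.
split; last first.
{ move=> X00 Y00 Z00; move: Hp Hq Hr; rewrite X00 Y00 Z00 => -[E1 E2] [E3 E4].
  case: ox oy oz E1 E2 E3 E4 => [] [] [] /= E1 E2 E3 E4; subst => //.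
  all: rewrite /crossing_at /strands /=.
  all: case: (or) => [[]|] /=; case: (c) => /= -[E5 E6]; subst; split.
  all: by rewrite ?(mulr0, addr0). }
(* After the move only a virtual crossing lies between the inner segment of y or z and one end of
   that strand, so the color is that of this end. *)
exists X0, (if oy then Y1 else Y0), (if oz then Z1 else Z0).
rewrite /triangle_coloring /crossing_at /= /strands !eqxx !nb.
move: Hr; rewrite /crossing_at /strands.
by case: ox oy oz Hp Hq => [] [] [] /= [E1 E2] [E3 E4] [E5 E6]; subst; split.
Qed.

(* The two parity conditions encode the planarity of the triangle. *)
Lemma triangle_coloring_real a b c ox oy oz X0 X1 Y0 Y1 Z0 Z1 x y z :
  oy (+) a = oz (+) b -> ox (+) a = oz (+) c ->
  triangle_coloring (Some a) (Some b) (Some c) a b c ox oy oz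
    X0 X1 Y0 Y1 Z0 Z1 x y z ->
  (exists x' y' z', triangle_coloring (Some a) (Some b) (Some c) a b c
     (~~ ox) (~~ oy) (~~ oz) X0 X1 Y0 Y1 Z0 Z1 x' y' z') /\
  (X0 = 0 -> Y0 = 0 -> Z0 = 0 -> [/\ x = 0, y = 0 & z = 0]).
Proof.
rewrite /triangle_coloring /crossing_at /= /strands !eqxx.
have nb j : (~~ j == j) = false by case: j.
rewrite !nb => h1 h2 H; split; last first.
  move=> X00 Y00 Z00; move: H; rewrite {}X00 {}Y00 {}Z00.
  case: a b c ox oy oz h1 h2 => [] [] [] [] [] [] //= _ _;
    move=> [[E1 E2] [E3 E4] [E5 E6]]; subst;
    by rewrite !(mulr0, addr0); split; rewrite ?(mulr0, addr0).
(* The new inner colors are computed from the top strand down, in the order of passages after the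
   move: [w1] for x, then [w2] for y under x, then [w3] for z under both. *)
pose w1 := signed (if ox then b else a) s * X0.
pose under j u v := signed j t * v + (1 - signed j s * signed j t) * u.
pose w2 := if oy then signed c s * Y0
           else under a (if ox then w1 else X0) Y0.
pose w3 := if oz then under c (if oy then Y0 else w2) Z0
           else under b (if ox then X0 else w1) Z0.
exists w1, w2, w3; rewrite /w3 /w2 /w1 /under {w1 w2 w3 under}.
(* The parity conditions leave 16 of the 64 cases. *)
case: a b c ox oy oz h1 h2 H => [] [] [] [] [] [] //= _ _.
all: move=> [[E1 E2] [E3 E4] [E5 E6]]; subst.
all: by split; split; field; rewrite ?s0 ?t0.
Qed.

Lemma move3_colorable_imp (V E F : finType) (D D' : vmap V E F) :
  plane D -> move3 D D' -> colorable D -> colorable D'.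
Proof.
move=> pD [p [q [r [a [b [c [ex [ey [ez [f]]]]]]]]]].
move=> /= [[uniq_pqr overD oE] [[rx ry rz same] [_ _ [_ polyf] _]]].
have [ox [[xi xo xi' xo'] [Xi Xo]]] := reversed_order rx.
have [oy [[yi yo yi' yo'] [Yi Yo]]] := reversed_order ry.
have [oz [[zi zo zi' zo'] [Zi Zo]]] := reversed_order rz.
set I := [set ex; ey; ez] in polyf.
have inj := plane_inc pD; have injo := plane_out pD.
have [pq pr qr] : [/\ p != q, p != r & q != r].
  by move: uniq_pqr; rewrite /= !inE !negb_or -andbA => /and4P[].
have nb j : (~~ j == j) = false by case: j.
have bn j : (j == ~~ j) = false by case: j.
have pqrE :=
  (negPf pq, negPf pr, negPf qr, (eq_sym q p), (eq_sym r p), (eq_sym r q)).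
have inI w j : (inc D (w, j) \in I) =
    [|| (w, j) == (if ox then (q, b) else (p, a)),
        (w, j) == (if oy then (r, c) else (p, ~~ a))
      | (w, j) == (if oz then (r, ~~ c) else (q, ~~ b))].
  by rewrite !inE -orbA -{1}xi -{1}yi -{1}zi !(inj_eq inj).
have outI w j : (out D (w, j) \in I) =
    [|| (w, j) == (if ox then (p, a) else (q, b)),
        (w, j) == (if oy then (p, ~~ a) else (r, c))
      | (w, j) == (if oz then (q, ~~ b) else (r, ~~ c))].
  by rewrite !inE -orbA -{1}xo -{1}yo -{1}zo !(inj_eq injo).
have offI w j : w \notin [:: p; q; r] ->
    inc D (w, j) \notin I /\ out D (w, j) \notin I.
  rewrite inI outI !inE !negb_or => /and3P[wp wq wr].
  by split; case: (ox); case: (oy); case: (oz);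
    rewrite /= !xpair_eqE ?(negPf wp) ?(negPf wq) ?(negPf wr).
apply: (@colorable_recolor _ _ _ D D' [set v in [:: p; q; r]] I).
  move=> w j; rewrite inE => wS; have [-> ->] := same w j wS.
  by have [] := offI w j wS; split.
move=> k kP.
pose X0 := inc D (if ox then (p, a) else (q, b)).
pose X1 := out D (if ox then (q, b) else (p, a)).
pose Y0 := inc D (if oy then (p, ~~ a) else (r, c)).
pose Y1 := out D (if oy then (r, c) else (p, ~~ a)).
pose Z0 := inc D (if oz then (q, ~~ b) else (r, ~~ c)).
pose Z1 := out D (if oz then (r, ~~ c) else (q, ~~ b)).
have ext : [/\ [/\ X0 \notin I, Y0 \notin I & Z0 \notin I] &
               [/\ X1 \notin I, Y1 \notin I & Z1 \notin I]].
  rewrite /X0 /Y0 /Z0 /X1 /Y1 /Z1; split; split;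
    move: inI outI; case: (ox); case: (oy); case: (oz) => /= inI outI;
    by rewrite ?inI ?outI !xpair_eqE !pqrE ?nb ?bn ?andbF.
have exI : ex \in I by rewrite !inE eqxx.
have eyI : ey \in I by rewrite !inE eqxx orbT.
have corner w d (o1 o2 : bool) e :
    (if o1 then out D (w, d) else inc D (w, d)) = e -> e \in I ->
    (if ~~ o2 then out D (w, ~~ d) else inc D (w, ~~ d)) \notin I ->
    (lface D e == f) = o2 (+) d.
  move=> eE eI oI; rewrite -[in LHS]eE.
  have := @corner_side _ _ _ D pD w d o1 o2 f; rewrite /=.
  by rewrite eE !polyf eI (negPf oI) => ->.
have tri : triangle_coloring (over D p) (over D q) (over D r) a b c ox oy oz
  (k X0) (k X1) (k Y0) (k Y1) (k Z0) (k Z1) (k ex) (k ey) (k ez).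
  have := (colored_atE D k p a).1 (kP p).
  have := (colored_atE D k q b).1 (kP q).
  have := (colored_atE D k r c).1 (kP r).
  rewrite /X0 /X1 /Y0 /Y1 /Z0 /Z1 /triangle_coloring.
  by case: (ox) xi xo; case: (oy) yi yo; case: (oz) zi zo => /= -> -> -> -> -> ->.
have [[x' [y' [z' tri']]] zero] :
   (exists x' y' z', triangle_coloring (over D p) (over D q) (over D r) a b c
     (~~ ox) (~~ oy) (~~ oz) (k X0) (k X1) (k Y0) (k Y1) (k Z0) (k Z1)
     x' y' z') /\
  (k X0 = 0 -> k Y0 = 0 -> k Z0 = 0 -> [/\ k ex = 0, k ey = 0 & k ez = 0]).
  case: overD tri => [[-> -> ->]|[-> ->]]; last exact: triangle_coloring_virtual.
  (* The parity conditions compare the side of an edge on which [f] lies, as read at its two ends: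
     at [p] and [q] for [ex], at [p] and [r] for [ey]. *)
  apply: triangle_coloring_real.
    by rewrite -(corner p a ox oy ex) ?(corner q b (~~ ox) oz ex) //;
      move: inI outI xi xo; case: (ox); case: (oy); case: (oz);
      move=> /= inI outI xi xo;
      rewrite ?inI ?outI ?xi ?xo ?exI ?xpair_eqE ?pqrE ?nb ?bn ?andbF.
  suff : ox (+) ~~ a = ~~ oz (+) c by rewrite addbN addNb => /negb_inj.
  by rewrite -(corner p (~~ a) oy ox ey) ?(corner r c (~~ oy) (~~ oz) ey) //;
    move: inI outI yi yo; case: (ox); case: (oy); case: (oz) => /= inI outI yi yo;
    rewrite ?negbK ?inI ?outI ?yi ?yo ?eyI ?xpair_eqE ?pqrE ?nb ?bn ?andbF.
have [[X0I Y0I Z0I] [X1I Y1I Z1I]] := ext.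
split; last first.
  move=> z; have [kx ky kz] := zero (z _ X0I) (z _ Y0I) (z _ Z0I).
  by move=> e; rewrite !inE -orbA => /or3P[] /eqP->.
have exy : (ey == ex) = false.
  rewrite -xi -yi (inj_eq inj).
  by case: (ox); case: (oy); rewrite /= !xpair_eqE ?pqrE ?nb ?bn ?andbF.
have exz : (ez == ex) = false.
  rewrite -xi -zi (inj_eq inj).
  by case: (ox); case: (oz); rewrite /= !xpair_eqE ?pqrE ?nb ?bn ?andbF.
have eyz : (ez == ey) = false.
  rewrite -yi -zi (inj_eq inj).
  by case: (oy); case: (oz); rewrite /= !xpair_eqE ?pqrE ?nb ?bn ?andbF.
pose k' e := if e == ex then x' else if e == ey then y' else
             if e == ez then z' else k e.
have k'I e : e \notin I -> k' e = k e.
  by rewrite !inE !negb_or -andbA /k' => /and3P[/negPf-> /negPf-> /negPf->].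
have k'x : k' ex = x' by rewrite /k' eqxx.
have k'y : k' ey = y' by rewrite /k' exy eqxx.
have k'z : k' ez = z' by rewrite /k' exz eyz eqxx.
exists k' => //.
move: tri'; rewrite -k'x -k'y -k'z -!k'I // /X0 /X1 /Y0 /Y1 /Z0 /Z1.
rewrite -Xi -Xo -Yi -Yo -Zi -Zo => -[Tp Tq Tr] v; rewrite !inE => /or3P[] /eqP->.
- apply/(colored_atE _ _ _ a); rewrite oE.
  by case: (ox) xi' xo' Tp; case: (oy) yi' yo' => /= e1 e2 e3 e4;
    rewrite ?e1 ?e2 ?e3 ?e4.
- apply/(colored_atE _ _ _ b); rewrite oE.
  by case: (ox) xi' xo' Tq; case: (oz) zi' zo' => /= e1 e2 e3 e4;
    rewrite ?e1 ?e2 ?e3 ?e4.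
- apply/(colored_atE _ _ _ c); rewrite oE.
  by case: (oy) yi' yo' Tr; case: (oz) zi' zo' => /= e1 e2 e3 e4;
    rewrite ?e1 ?e2 ?e3 ?e4.
Qed.

Lemma move3_colorable (V E F : finType) (D D' : vmap V E F) :
  plane D -> plane D' -> move3 D D' -> colorable D <-> colorable D'.
Proof.
move=> pD pD' mv; split; first exact: move3_colorable_imp.
exact/move3_colorable_imp/move3_sym.
Qed.

End Coloring.

(** * The determinant *)

Lemma classical_colorable (R : fieldType) (s t : R) (K : diagram) :
  s != 0 -> t != 0 -> classical K -> (0 < #|edge K|)%N -> colorable s t K.
Proof.
move=> s0 t0 clK /card_gt0P[e0 _].
have [lam lamE] := alexander_numbering (map_plane K).
pose c e := s ^ (- lam (lface K e)); exists c; last first.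
  by exists e0; rewrite expfz_neq0.
have [_ _ _ NE NW SW SE _ _] := map_plane K.
move=> v.
have step e : s ^ (- lam (rface K e)) = s * s ^ (- lam (lface K e)).
  by rewrite lamE opprD addrC expfzDr // exprN1 mulVKf.
(* The west and north edges have the same color, the east and south edges [s] times it; the
   relations become identities in [s] and [t]. *)
have c1 : c (out K (v, true)) = c (inc K (v, false)) by rewrite /c NW.
have c2 : c (out K (v, false)) = s * c (inc K (v, false)).
  by rewrite /c NE step NW.
have c3 : c (inc K (v, true)) = s * c (inc K (v, false)).
  by rewrite /c -SW step.
rewrite /colored_at /cross; case: (over K v) (clK v) => // o _.
case=> /=; case: o; rewrite /= ?c1 ?c2 ?c3; field; by rewrite ?s0 ?t0.
Qed.

(** * Invariance under equivalence *)

Lemma move_colorable (R : fieldType) (s t : R) (K L : diagram) :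
  s != 0 -> t != 0 -> move K L -> colorable s t K <-> colorable s t L.
Proof.
move=> s0 t0; case=> {K L}.
- move=> K L [h [k [r [[[h' hK h'K] [k' kK k'K] _] [oE iE uE _ _]]]]].
  split=> -[c cP [e ce]].
    exists (c \o k'); last by exists (k e); rewrite /= kK.
    move=> v i; rewrite -[v]h'K /= uE kK cP oE.
    by congr cross; apply: funext => j; rewrite iE kK.
  exists (c \o k); last by exists (k' e); rewrite /= k'K.
  move=> v i /=; rewrite -uE cP oE.
  by congr cross; apply: funext => j; rewrite iE.
- by move=> K L; apply: move1_colorable => //; apply: map_plane.
- by move=> K L; apply: move2_colorable => //; apply: map_plane.
- by move=> V E F D D' hD hD'; apply: move3_colorable.
Qed.

(** A nonzero coloring of the classical diagram needs an edge, which is obtained from an edge of the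
    given diagram. *)
Lemma move_edge (K L : diagram) : move K L ->
  (exists e : edge K, True) <-> (exists e : edge L, True).
Proof.
have surj (E' E : finType) (k : E' -> E) : (forall e, exists e', k e' = e) ->
    (exists e : E', True) <-> (exists e : E, True).
  by move=> kS; split=> -[e _]; [exists (k e) | have [e' _] := kS e; exists e'].
case=> {K L} //.
- move=> K L [_ [k [_ [[_ [k' _ k'K] _] _]]]].
  by apply: (surj _ _ k) => e; exists (k' e).
- by move=> K L [_ [_ [_ [_ [_ [k [_ [[_ _ /surj kS _] _]]]]]]]].
- by move=> K L [_ [_ [_ [_ [_ [_ _ _ _ [_ [k [_ [[_ _ /surj kS _] _]]]]]]]]]].
Qed.

Lemma equivalent_invariant (P : diagram -> Prop) :
  (forall K L, move K L -> P K <-> P L) ->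
  forall K L, equivalent K L -> P K <-> P L.
Proof.
move=> H K L; elim=> {K L} [K L /H //|//|K L _ [? ?]|K L M _ [? ?] _ [? ?]].
  by split.
by split; auto.
Qed.

(** * Colorings as kernel vectors of the Alexander matrix *)

Lemma arc_in_arcs (K : diagram) (e : edge K) : arc e \in @arcs K.
Proof.
apply: roots_root; apply: sym_connect_sym => x y.
by apply: eq_existsb => p; rewrite orbC.
Qed.

Lemma sum_arcs (K : diagram) (c : edge K -> ratfun) (e : edge K) :
  (forall e, c (arc e) = c e) ->
  \sum_(j < #|@arcs K|) (val ((arc e == enum_val j)%:R : laurent) : ratfun)
      * c (enum_val j) = c e.
Proof.
move=> cE.
have eA := arc_in_arcs e.
rewrite (bigD1 (enum_rank_in eA (arc e))) //= enum_rankK_in // eqxx rmorph1 mul1r.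
rewrite cE big1 ?addr0 // => j jA.
case: eqP => [E|]; last by rewrite rmorph0 mul0r.
by case/eqP: jA; apply: enum_val_inj; rewrite enum_rankK_in.
Qed.

Lemma signed_exp (R : fieldType) (x : R) o : x ^ crossing_sign o = signed o x.
Proof. by case: o; rewrite ?exprN1 ?expr1z. Qed.

(** Virtual crossings pass colors on, so a coloring is constant along arcs. Its values at their
    representatives form a nonzero kernel vector over the fraction field, in which the Laurent ring
    embeds. *)
Lemma det_alexander_eq0 (K : diagram) :
  colorable sfrac tfrac K -> \det (alexander_matrix K) = 0.
Proof.
move=> [c cP [e ce]].
have cE e' : c (arc e') = c e'.
  rewrite /arc; have /connectP[p + ->] := connect_root (@same_arc K) e'.
  elim: p e' => [|h p IHp] e' //= /andP[/existsP[[v i]]].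
  rewrite !inE => /= /andP[/eqP ov e'h] /IHp ->.
  have := cP v i; rewrite /cross ov.
  by case/orP: e'h => /andP[/eqP-> /eqP->].
(* The kernel vector is a column, whereas [det0P] concerns rows; hence the transpose. *)
apply: val_inj; rewrite rmorph0 -det_map_mx -det_tr.
apply/eqP/det0P; exists (\row_j c (enum_val j)).
  have eA := arc_in_arcs e.
  apply: contra_neq ce => /rowP/(_ (enum_rank_in eA (arc e))).
  by rewrite !mxE enum_rankK_in // cE.
apply/rowP => i; rewrite !mxE.
pose vl : {rmorphism laurent -> ratfun} := val.
transitivity (\sum_(j < #|@arcs K|)
    vl (matrix_coef (enum_val i) (enum_val j)) * c (enum_val j)).
  by apply: eq_bigr => j _; rewrite !mxE mulrC.
rewrite /matrix_coef; case: pickP => [[v k] /andP[ov _]|_]; last first.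
  by rewrite big1 // => j _; rewrite rmorph0 mul0r.
have {}ov : over K v != None by [].
have := cP v k; rewrite /colored_at /cross /relation_coef.
rewrite [(v, k).1]/= [(v, k).2]/=.
case: (over K v) ov => // o _.
have vl_arcs e' : \sum_(j < #|@arcs K|)
    vl (arc e' == enum_val j)%:R * c (enum_val j) = c e' by exact: sum_arcs.
have valm a b : vl (monomial a b) = sfrac ^ a * tfrac ^ b by [].
have [->|ko] := eqVneq k o.
  (* The row applied to the coloring is the difference of the two sides of the coloring equation at
     this passage. *)
  move=> /eqP; rewrite -subr_eq0 => /eqP E; rewrite -[RHS]E.
  under eq_bigr => j _ do
    rewrite rmorphB rmorphM mulrBl -mulrA valm expr0z mulr1 signed_exp.
  by rewrite sumrB -mulr_sumr !vl_arcs.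
move=> /eqP; rewrite -subr_eq0 => /eqP E; rewrite -[RHS]E.
under eq_bigr => j _ do
  rewrite rmorphB rmorphD !rmorphM rmorphB rmorph1 !valm mulrBl mulrDl
          -!mulrA !expr0z mul1r !signed_exp.
by rewrite sumrB big_split /= -!mulr_sumr !vl_arcs.
Qed.

(* The empty diagram, for which the determinant of the empty matrix is 1, is not
   a knot or link diagram. *)
Theorem mainTheorem1 (K : diagram) (hK : (0 < #|edge K|)%N)
    (G : laurent) (hG : gen_alexander K G)
    (hcl : exists K0 : diagram, classical K0 /\ equivalent K K0) :
  G = 0%R.
Proof.
have [n [i [j ->]]] := hG; have [K0 [clK0 KK0]] := hcl.
rewrite det_alexander_eq0 ?mulr0 //.
apply/(equivalent_invariant
         (fun _ _ => move_colorable sfrac_neq0 tfrac_neq0) KK0).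
apply: (classical_colorable sfrac_neq0 tfrac_neq0 clK0).
have [e _] := (equivalent_invariant move_edge KK0).1
                (ex_intro _ (enum_val (Ordinal hK)) I).
by apply/card_gt0P; exists e.
Qed.
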